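(* Let $n\geq 2$, let $a_1,a_2,\dots,a_n$ be positive integers with $\gcd(a_1,a_2,\dots,a_n)=1$, let $M$ be the least common multiple of $a_1,\dots,a_n$, and let $b$ be a non-negative integer. If either $$b\geq nM-\sum_{i=1}^{n}a_i \quad\text{or}\quad b\geq (n-1)M,$$ then the equation $\sum_{i=1}^{n}a_ix_i=b$ is solvable in non-negative integers $x_1,\dots,x_n$. *)

(* Defs.v *)
From mathcomp Require Import all_boot.
Set Implicit Arguments.
Unset Strict Implicit.
Unset Printing Implicit Defensive.

(* Main.v *)
Require Import Defs.
From mathcomp Require Import all_boot.

(** Let [M] be the least common multiple of the coefficients.  Because they are
    coprime, the congruence [\sum_i a i * y i = b %[mod M]] has a solution
    (Bezout, lemma [gcd_combination_mod]).  Each term may be replaced by its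
    remainder modulo [M]: as [a i] divides [M], this remainder is still a
    multiple of [a i], and being smaller than [M] it is at most [M - a i].
    Reduce in this way all the terms except one, of index [j].  The reduced
    terms then sum to at most [(n - 1) M - \sum_(i != j) a i], and [b] is at
    least this number under either alternative of the hypothesis.  What is
    missing to reach [b] is therefore non-negative, and the congruence makes it
    a multiple of [a j], so the variable of index [j] can supply it. *)

(** Negative Bezout coefficients are avoided by working modulo [m], where
    [m - 1] stands for [-1].  The combinations of the [a i] modulo [m] then
    form a set closed under sums and multiples, hence under [gcdn], and the
    iterated gcd lies in it. *)
Lemma gcd_combination_mod (I : finType) (a : I -> nat) (m : nat) :
  0 < m ->
  exists y : I -> nat,
    \sum_i a i * y i = \big[gcdn/0]_i a i %[mod m].
Proof.
move=> m_gt0.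
apply: (big_ind (fun k => exists y : I -> nat, \sum_i a i * y i = k %[mod m])).
- by exists (fun=> 0); rewrite big1 // => i _; rewrite muln0.
- move=> k l [y Hy] [z Hz].
  have [->|k_gt0] := posnP k; first by rewrite gcd0n; exists z.
  case: (egcdnP l k_gt0) => u v Huv _.
  (* gcdn k l = u * k - v * l, and -1 is m.-1 modulo m. *)
  exists (fun i => u * y i + m.-1 * v * z i).
  have -> : \sum_i a i * (u * y i + m.-1 * v * z i) =
      u * (\sum_i a i * y i) + m.-1 * v * (\sum_i a i * z i).
    rewrite !big_distrr -big_split; apply: eq_bigr => i _ /=.
    by rewrite mulnDr !(mulnCA (a i)).
  rewrite -modnDm -modnMmr Hy modnMmr -(modnMmr _ (\sum_i a i * z i)) Hz.
  rewrite modnMmr modnDm Huv addnAC -mulnA -mulSn prednK //.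
  by rewrite mulnC modnMDl.
- move=> i _; exists (fun j => (j == i : nat)).
  rewrite (bigD1 i) //= eqxx muln1 big1 ?addn0 // => j /negPf ->.
  by rewrite muln0.
Qed.

(** The reason is that [M - d] is the largest multiple of [d] below [M]. *)
Lemma modn_multiple_leq (d M k : nat) :
  0 < M -> d %| M -> d %| k -> k %% M + d <= M.
Proof.
move=> M_gt0 dM dk; have r_lt : k %% M < M by rewrite ltn_mod.
have dr : d %| k %% M by rewrite /dvdn modn_dvdm.
have gap : d <= M - k %% M by rewrite dvdn_leq ?subn_gt0 ?dvdn_sub.
by rewrite -leq_subRL ?(ltnW r_lt).
Qed.

(** A bound covering both alternatives of the theorem: it follows from
    [n * M - \sum_i a i <= b] by adding [a j <= M], and from [n.-1 * M <= b] by
    dropping the sum. *)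
Lemma solvable_of_leq (I : finType) (a : I -> nat) (M b : nat) (j : I) :
    0 < M -> (forall i, a i %| M) -> \big[gcdn/0]_i a i = 1 ->
    #|I|.-1 * M <= b + \sum_(i | i != j) a i ->
  exists x : I -> nat, \sum_i a i * x i = b.
Proof.
move=> M_gt0 aM gcd1 le_b.
have [u Hu] := @gcd_combination_mod I a M M_gt0; rewrite gcd1 in Hu.
pose r i := (a i * (u i * b)) %% M.
have ar i : a i %| r i by rewrite /r /dvdn modn_dvdm // -/(dvdn _ _) dvdn_mulr.
pose S := \sum_(i | i != j) r i.
have le_S : S <= b.
  rewrite -(leq_add2r (\sum_(i | i != j) a i)); apply: leq_trans le_b.
  rewrite -big_split -(cardC1 j) -sum_nat_const /=.
  by apply: leq_sum => i _; apply: modn_multiple_leq; rewrite // dvdn_mulr.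
have S_b : r j + S = b %[mod M].
  have -> : r j + S = \sum_i r i by rewrite (bigD1 j).
  rewrite modn_summ -[RHS](congr1 (modn^~ M) (mul1n b)) -modnMml -Hu modnMml.
  by rewrite big_distrl; congr (_ %% M); apply: eq_bigr => i _; rewrite mulnA.
have aj_gap : a j %| b - S.
  rewrite -eqn_mod_dvd // eq_sym -(modn_dvdm b (aM j)) -S_b modn_dvdm //.
  by rewrite -modnDml (eqP (ar j)).
exists (fun i => if i == j then (b - S) %/ a j else r i %/ a i).
rewrite (bigD1 j) //= eqxx mulnC divnK //.
rewrite (eq_bigr r) ?subnK // => i /negPf ->.
by rewrite mulnC divnK.
Qed.

Theorem proposition2p2 (n : nat) (a : 'I_n -> nat) (b : nat)
    (hn : 2 <= n)
    (ha : forall i : 'I_n, 0 < a i)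
    (hgcd : \big[gcdn/0]_(i < n) a i = 1)
    (hb : n * \big[lcmn/1]_(i < n) a i - \sum_(i < n) a i <= b \/
          n.-1 * \big[lcmn/1]_(i < n) a i <= b) :
  exists x : 'I_n -> nat, \sum_(i < n) a i * x i = b.
Proof.
move: hb; set M := \big[lcmn/1]_(i < n) a i => hb.
have M_gt0 : 0 < M.
  by apply: (big_ind (fun k => 0 < k)) => // k l; rewrite lcmn_gt0 => -> ->.
have aM i : a i %| M by apply: biglcmn_sup.
pose j : 'I_n := Ordinal (ltnW hn).
apply: (@solvable_of_leq _ a M b j) => //; rewrite card_ord.
case: hb => [|/leq_trans -> //]; last exact: leq_addr.
rewrite leq_subLR (bigD1 j) //= => le_b.
rewrite -(leq_add2l M) -mulSn prednK ?(ltnW hn) //.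
apply: (leq_trans le_b).
by rewrite -addnA (addnC b) leq_add2r dvdn_leq.
Qed.
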